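(* Let $n\ge 3$ and let $m$ be an integer with $2\leq m\leq \lceil \frac{n}{2}\rceil$. Let $P_n$ be the path with $n$ edges. Then $$rb(P_n,mK_2)=\begin{cases} 2m-1, & n\leq 3m-3,\\ 2m-2, & n>3m-3.\end{cases}$$
   Context: All graphs are simple and finite. $P_n$ denotes the path with $n$ edges (and $n+1$ vertices). $mK_2$ denotes a matching of size $m$ (that is, $m$ pairwise disjoint edges). An edge-coloring of a graph $G$ with $r$ colors is an arbitrary (not necessarily proper) assignment of colors to the edges of $G$ in which exactly $r$ distinct colors appear. A subgraph of an edge-colored graph is rainbow if no two of its edges have the same color. For a graph $G$ and a subgraph $H$ of $G$, the rainbow number $rb(G,H)$ is the minimum positive integer $r$ such that every edge-coloring of $G$ with $r$ colors contains a rainbow subgraph isomorphic to $H$. *)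

(* Defs.v *)
From mathcomp Require Import all_boot.

Set Implicit Arguments.
Unset Strict Implicit.
Unset Printing Implicit Defensive.

Record sgraph := SGraph {
  vertex :> finType;
  adj : rel vertex;
  adj_sym : symmetric adj;
  adj_irr : irreflexive adj
}.

Definition edges (G : sgraph) : {set {set G}} :=
  [set [set p.1; p.2] | p : G * G & adj p.1 p.2].

Definition path_adj n : rel 'I_n.+1 :=
  fun i j => (i.+1 == j :> nat) || (j.+1 == i :> nat).

Lemma path_adj_sym n : symmetric (@path_adj n).
Proof. by move=> i j; rewrite /path_adj orbC. Qed.

Lemma path_adj_irr n : irreflexive (@path_adj n).
Proof. by move=> i; rewrite /path_adj orbb gtn_eqF. Qed.

(* [n] counts edges: there are [n.+1] vertices. *)
Definition path_graph n : sgraph :=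
  SGraph (@path_adj_sym n) (@path_adj_irr n).

Definition matching_adj m : rel ('I_m * bool) :=
  fun x y => (x.1 == y.1) && (x.2 != y.2).

Lemma matching_adj_sym m : symmetric (@matching_adj m).
Proof. by move=> x y; rewrite /matching_adj eq_sym [x.2 == _]eq_sym. Qed.

Lemma matching_adj_irr m : irreflexive (@matching_adj m).
Proof. by move=> x; rewrite /matching_adj !eqxx. Qed.

(* The [m] disjoint edges are [{(i, false), (i, true)}] for [i : 'I_m]. *)
Definition matching_graph m : sgraph :=
  SGraph (@matching_adj_sym m) (@matching_adj_irr m).

(* The subgraphs of [G] isomorphic to [H] are the images of the embeddings
   of [H] in [G]; they need not be induced. *)
Definition embedding (H G : sgraph) (f : {ffun H -> G}) : bool :=
  injectiveb f && [forall x, forall y, adj x y ==> adj (f x) (f y)].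

Definition copy_edges (H G : sgraph) (f : {ffun H -> G}) : {set {set G}} :=
  [set f @: (e : {set H}) | e in edges H].

Definition rainbow (G : sgraph) r (c : {ffun {set G} -> 'I_r})
    (F : {set {set G}}) : bool :=
  dinjectiveb c F.

Definition has_rainbow (G H : sgraph) r (c : {ffun {set G} -> 'I_r}) : bool :=
  [exists f : {ffun H -> G}, embedding f && rainbow c (copy_edges f)].

(* A colouring is a total function on vertex sets, but only its values on
   [edges G] are ever used. With [r] colours appearing, these can be named by
   the elements of ['I_r]. *)
Definition colors_used (G : sgraph) r (c : {ffun {set G} -> 'I_r}) : {set 'I_r} :=
  [set c e | e in edges G].

Definition forces_rainbow (G H : sgraph) r : bool :=
  [forall c : {ffun {set G} -> 'I_r},
     (#|colors_used c| == r) ==> has_rainbow H c].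

(* No colouring of [G] uses more than [#|edges G|] colours, so the minimum
   defining the rainbow number is over a nonempty set. *)
Lemma forces_rainbow_ex (G H : sgraph) :
  exists r, (0 < r) && forces_rainbow G H r.
Proof.
exists #|edges G|.+1; apply/forallP => c; apply/implyP => /eqP used.
by have := leq_imset_card c (mem (edges G)); rewrite -/(colors_used c) used ltnn.
Qed.

Definition rb (G H : sgraph) : nat := ex_minn (forces_rainbow_ex G H).

(* Main.v *)
(** Number the edges of the path from left to right, so that a matching is a
    set of pairwise non-consecutive positions.

    Lower bounds: group the positions into [m - 1] classes such that two
    positions of one class have the same colour or are consecutive; a rainbow
    matching then has at most one edge in each class. For [n <= 3m - 3] the
    classes are consecutive blocks coloured [x y x] or [x y].

    Upper bounds: let [a] select at most one position of each colour. Every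
    second selected position gives a rainbow matching, and one edge is gained
    whenever an odd number of selected positions is followed by an unselected
    one. Hence, if [a] selects the first occurrences of [2m - 2] colours and
    there is no rainbow [mK_2], each unselected position has an even number of
    selected ones to its left. Two unselected positions are not consecutive:
    exchanging the second one for the first occurrence of its colour would
    break that parity. So each unselected position is preceded by two selected
    ones of its own, and [n <= 3(m - 1)]. *)

Require Import Defs.
From mathcomp Require Import all_boot.
From mathcomp Require Import zify.

Set Implicit Arguments.
Unset Strict Implicit.
Unset Printing Implicit Defensive.

(** * Counting in selections of positions *)

Section Selections.

Implicit Types (a : pred nat) (n p q : nat).

Definition below a q := count a (iota 0 q).

Lemma belowS a q : below a q.+1 = below a q + a q.
Proof. by rewrite /below -addn1 iotaD count_cat /= add0n addn0. Qed.

(* Among the positions selected by [a], those of even rank before [p] and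
   those of odd rank from [p] on. *)
Definition alternate a p : pred nat :=
  fun x => a x && (odd (below a x) == (p <= x)).

(** Adjacent selected positions have ranks of opposite parity, so both are kept only if [p = x.+1],
    which the first hypothesis rules out. *)
Lemma alternate_spaced a n p x : (p < n -> ~~ a p.-1) -> x.+1 < n ->
  alternate a p x -> ~~ alternate a p x.+1.
Proof.
move=> ap xn /andP[ax /eqP px]; apply/negP => /andP[_ /eqP].
rewrite belowS ax oddD {}px /=.
have [pE | ne] := eqVneq p x.+1; first by have := ap; rewrite pE xn ax => /(_ isT).
by case: (leqP p x) => ?; case: (leqP p x.+1) => ? //; lia.
Qed.

(** If [below a p] is [2k + 1], rank [2k] is the last one kept before [p] and rank [2k + 1] is kept
    from [p] on if it occurs: the switch keeps two successive ranks, which is the gain. *)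
Lemma below_alternate a n p : p <= n -> odd (below a p) ->
  below (alternate a p) n = (below a n)./2.+1.
Proof.
move=> le_pn odd_p.
have low q : q <= p -> below (alternate a p) q = uphalf (below a q).
  elim: q => // q IH lt_qp; rewrite !belowS IH ?(ltnW lt_qp) // /alternate.
  by rewrite leqNgt lt_qp /=; case: (a q) => /=; lia.
elim: n le_pn => [|n IH] le_pn; first by move: le_pn odd_p; case: p {low}.
case: (eqVneq p n.+1) => [<- | ne]; first by rewrite low //; lia.
have le_pn' : p <= n by lia.
rewrite !belowS IH // /alternate le_pn'.
by case: (a n) => /=; lia.
Qed.

Definition exchange a s p : pred nat :=
  fun x => (x != s) && ((x == p) || a x).

Lemma below_exchange a s p q : a s -> ~~ a p ->
  below (exchange a s p) q + (s < q) = below a q + (p < q).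
Proof.
move=> sa pa; have ne : s != p by apply: contraNneq pa => <-.
elim: q => // q IH; rewrite !belowS [exchange a s p q]/exchange.
have [qs | qs] := eqVneq q s; first by rewrite qs sa in IH *; lia.
have [qp | qp] := eqVneq q p; first by rewrite qp (negbTE pa) in IH *; lia.
by rewrite /=; lia.
Qed.

Lemma unselected_le a n :
  (forall p, p < n -> ~~ a p -> ~~ odd (below a p)) ->
  (forall p, p < n -> ~~ a p -> 0 < p /\ a p.-1) ->
  n <= below a n + (below a n)./2.
Proof.
move=> even_a isol_a.
(* At an unselected [q] the invariant reads [2 * q + 1 <= 3 * below a q]; the right side is even, so
   one more unit fits. *)
suff inv q : q <= n ->
    2 * q + ((0 < q) && a q.-1) <= 3 * below a q by have := inv n (leqnn n); lia.
elim: q => // q IH lt_qn; have := IH (ltnW lt_qn); rewrite belowS /=.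
have [aq | aq] := boolP (a q); first by lia.
have [q0 ->] := isol_a q lt_qn aq; rewrite q0.
by have := even_a q lt_qn aq; lia.
Qed.

End Selections.

(** * First occurrences of colours *)

Section FirstOccurrences.

Variables (C : finType) (w : nat -> C).

Definition partial_transversal n (a : pred nat) :=
  forall x y, x < n -> y < n -> a x -> a y -> w x = w y -> x = y.

Definition first_occ : pred nat := fun x => w x \notin map w (iota 0 x).

Lemma first_occ_transversal n : partial_transversal n first_occ.
Proof.
have earlier x y : x < y -> w x = w y -> ~~ first_occ y.
  by move=> lt_xy wxy; rewrite negbK; apply/mapP; exists x; rewrite ?mem_iota.
move=> x y _ _ fx fy wxy.
case: (ltngtP x y) => // /earlier; first by rewrite fy => /(_ wxy).
by rewrite fx => /(_ (esym wxy)).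
Qed.

Lemma first_occ_ex p : exists2 s, s <= p & first_occ s /\ w s = w p.
Proof.
have ex : exists s, w s == w p by exists p.
have [s /eqP ws smin] := ex_minnP ex.
exists s; first exact: smin; split=> //.
apply/mapP => -[x]; rewrite mem_iota => /= lt_xs wx.
by have := smin x; rewrite -wx ws eqxx => /(_ isT); lia.
Qed.

Lemma below_first_occ n : below first_occ n = #|[set w (i : 'I_n) | i : 'I_n]|.
Proof.
pose s := [seq x <- iota 0 n | first_occ x].
have ws_uniq : uniq (map w s).
  rewrite map_inj_in_uniq ?filter_uniq ?iota_uniq // => x y.
  rewrite !mem_filter !mem_iota => /andP[fx /= xn] /andP[fy yn].
  exact: (@first_occ_transversal n).
rewrite /below -size_filter -(size_map w) -(card_uniqP ws_uniq).
apply: eq_card => z; apply/mapP/imsetP => [[x] | [i _ ->]].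
  by rewrite mem_filter mem_iota => /andP[_ /= xn] ->; exists (Ordinal xn).
have [x lt_xi [fx wx]] := first_occ_ex i.
exists x => //; rewrite mem_filter fx mem_iota /=.
exact: leq_ltn_trans lt_xi (ltn_ord i).
Qed.

(** A position of colour [w p] selected by [a] can only be [s], which the exchange removes. *)
Lemma exchange_transversal n a s p : partial_transversal n a ->
  s < n -> a s -> w s = w p -> partial_transversal n (exchange a s p).
Proof.
move=> tr sn sa wsp x y xn yn /andP[xs ax] /andP[ys ay] wxy.
case/orP: ax => [/eqP xp | ax]; case/orP: ay => [/eqP yp | ay].
- by rewrite xp.
- by rewrite -(tr s y) ?eqxx // in ys; rewrite wsp -xp.
- by rewrite -(tr s x) ?eqxx // in xs; rewrite wsp -yp.
- exact: tr.
Qed.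

End FirstOccurrences.

(** * Edges and matchings of the path as positions *)

Section PathEdges.

Variable n : nat.

Definition path_edge (i : nat) : {set path_graph n} :=
  [set (inord i : 'I_n.+1); (inord i.+1 : 'I_n.+1)].

Lemma path_edgesP (e : {set path_graph n}) :
  reflect (exists2 i, i < n & e = path_edge i) (e \in edges (path_graph n)).
Proof.
apply: (iffP imsetP) => [[[x y]] | [i lt_in ->]].
  rewrite inE /= => adj_xy ->; rewrite /path_edge.
  case/orP: adj_xy => /eqP eq_xy.
    exists x; first by have := ltn_ord y; lia.
    by rewrite eq_xy !inord_val.
  exists y; first by have := ltn_ord x; lia.
  by rewrite eq_xy !inord_val setUC.
exists (inord i, inord i.+1) => //.
by rewrite inE /= /path_adj !inordK ?eqxx //; lia.
Qed.

Lemma colors_usedE r (c : {ffun {set path_graph n} -> 'I_r}) :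
  colors_used c = [set c (path_edge (i : 'I_n)) | i : 'I_n].
Proof.
apply/setP => z; apply/imsetP/imsetP => [[e] | [i _ ->]].
  by case/path_edgesP => i lt_in -> ->; exists (Ordinal lt_in).
by exists (path_edge i) => //; apply/path_edgesP; exists (nat_of_ord i).
Qed.

Lemma matching_edgesP m (e : {set matching_graph m}) :
  reflect (exists i, e = [set (i, false); (i, true)])
          (e \in edges (matching_graph m)).
Proof.
apply: (iffP imsetP) => [[[[i b] [j b']]] | [i ->]].
  rewrite inE /= /matching_adj /= => /andP[/eqP <- ne] ->; exists i.
  by case: b b' ne => [] [] //= _; rewrite setUC.
by exists ((i, false), (i, true)); rewrite // inE /= /matching_adj /= eqxx.
Qed.

(** Distinct colours make [p] injective; the last clause, read in both orders of [i] and [j], then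
    makes the edges disjoint. *)
Lemma has_rainbowP m r (c : {ffun {set path_graph n} -> 'I_r}) :
  reflect (exists p : 'I_m -> nat,
             [/\ forall i, p i < n,
                 injective (fun i => c (path_edge (p i)))
               & forall i j, (p i).+1 <> p j])
          (has_rainbow (matching_graph m) c).
Proof.
apply: (iffP existsP) => [[f /andP[/andP[/injectiveP f_inj f_adj] rb_f]] |].
  pose e i : {set matching_graph m} := [set (i, false); (i, true)].
  have e_edge i : e i \in edges (matching_graph m).
    by apply/matching_edgesP; exists i.
  have [p fe] : exists p : 'I_m -> 'I_n, forall i, f @: e i = path_edge (p i).
    apply: (@fin_all_exists _ _ (fun i (k : 'I_n) => f @: e i = path_edge k)) => i.
    suff /path_edgesP[k lt_kn ->] : f @: e i \in edges (path_graph n).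
      by exists (Ordinal lt_kn).
    apply/imsetP; exists (f (i, false), f (i, true)); last first.
      by rewrite /e imsetU1 imset_set1.
    have /forallP/(_ (i, false))/forallP/(_ (i, true))/implyP := f_adj.
    by rewrite inE; apply; rewrite /= /matching_adj /= eqxx.
  have p_inj : injective (fun i => c (path_edge (p i))).
    move=> i j; rewrite -!fe => eq_c.
    have eq_f : f @: e i = f @: e j.
      by move/dinjectiveP: rb_f; apply=> //; apply: imset_f.
    move/(imset_inj f_inj)/setP/(_ (i, false)): eq_f.
    by rewrite !inE /= !xpair_eqE eqxx /= !eqxx andbT andbF orbF => /esym/eqP.
  exists p; split=> // i j eq_p.
  (* The vertex [p j] lies in the images of both matching edges, so injectivity of [f] forces
     [i = j]. *)
  have : inord (p j) \in f @: e i by rewrite fe -eq_p !inE eqxx orbT.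
  have : inord (p j) \in f @: e j by rewrite fe !inE eqxx.
  case/imsetP => [[j' b']] ej -> /imsetP[[i' b]] ei /f_inj[ji _].
  have /eqP i'i : i' == i by move: ei; rewrite !inE !xpair_eqE -andb_orr => /andP[].
  have /eqP j'j : j' == j by move: ej; rewrite !inE !xpair_eqE -andb_orr => /andP[].
  by move: eq_p; rewrite -i'i -j'j ji; lia.
case=> p [p_n p_inj p_sp].
pose f := [ffun x : 'I_m * bool => inord (p x.1 + x.2) : 'I_n.+1].
have fE i b : f (i, b) = p i + b :> nat.
  by rewrite ffunE inordK //=; have := p_n i; case: b; lia.
have p_inj' i j : p i = p j -> i = j by move=> e; apply: p_inj; rewrite /= e.
have f_edge i : f @: [set (i, false); (i, true)] = path_edge (p i).
  by rewrite imsetU1 imset_set1 !ffunE /= addn0 addn1.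
exists f; apply/andP; split.
  apply/andP; split.
    apply/injectiveP => -[i b] [j b'] /(congr1 (@nat_of_ord _)).
    rewrite !fE => e; have := p_sp i j; have := p_sp j i.
    by case: b b' e => [] [] /= e ? ?; try (by lia); rewrite (p_inj' i j) //; lia.
  apply/forallP => -[i b]; apply/forallP => -[j b']; apply/implyP.
  rewrite /= /matching_adj /path_adj /= => /andP[/eqP <- ].
  by rewrite !fE; case: b b' => [] [] //= _; apply/orP; lia.
apply/dinjectiveP => e1 e2 /imsetP[e /matching_edgesP[i ->] ->].
case/imsetP => e' /matching_edgesP[j ->] ->.
by rewrite !f_edge => /p_inj ->.
Qed.

End PathEdges.

(** * Upper and lower bounds *)

Section RainbowNumber.

Variables n m : nat.
Let P := path_graph n.
Let M := matching_graph m.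

(** The parity switches at [p]; the case [p = n] means no switch. *)
Lemma rainbow_of_selection r (c : {ffun {set P} -> 'I_r}) (a : pred nat) p :
  partial_transversal (fun i => c (path_edge n i)) n a ->
  p <= n -> odd (below a p) -> (p < n -> ~~ a p.-1) ->
  m <= (below a n)./2.+1 -> has_rainbow M c.
Proof.
move=> tr le_pn odd_p ap le_m; pose s := [seq x <- iota 0 n | alternate a p x].
have le_ms : m <= size s.
  by rewrite size_filter -/(below _ n) (below_alternate le_pn odd_p).
have s_uniq : uniq s by rewrite filter_uniq ?iota_uniq.
have s_i (i : 'I_m) : nth 0 s i < n /\ alternate a p (nth 0 s i).
  have : nth 0 s i \in s by rewrite mem_nth //; apply: leq_trans (ltn_ord i) _.
  by rewrite mem_filter mem_iota /= => /andP[].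
apply/has_rainbowP; exists (fun i => nth 0 s i); split=> [i | i j eq_c | i j eq_s].
- by have [] := s_i i.
- have [[ni /andP[ai _]] [nj /andP[aj _]]] := (s_i i, s_i j).
  have /eqP := tr _ _ ni nj ai aj eq_c.
  by rewrite nth_uniq ?(leq_trans (ltn_ord _) le_ms) // => /eqP/val_inj.
- have [[ni ai] [nj aj]] := (s_i i, s_i j).
  by move: (alternate_spaced ap (x := nth 0 s i)); rewrite eq_s aj => /(_ nj ai).
Qed.

Lemma forces_odd : 0 < m -> forces_rainbow P M (2 * m - 1).
Proof.
move=> m0; apply/forallP => c; apply/implyP => /eqP.
rewrite colors_usedE -(below_first_occ (fun i => c (path_edge n i))) => card_c.
apply: (rainbow_of_selection (@first_occ_transversal _ _ n) (leqnn n)).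
- by rewrite card_c; lia.
- by rewrite ltnn.
- by rewrite card_c; lia.
Qed.

Lemma forces_even : 1 < m -> 3 * m - 3 < n -> forces_rainbow P M (2 * m - 2).
Proof.
move=> m1 n_big; apply/forallP => c; apply/implyP => /eqP.
set w := fun i => c (path_edge n i).
rewrite colors_usedE -(below_first_occ w) => card_c.
apply: contraT => no_rb.
have even_sel a p : partial_transversal w n a -> below a n = 2 * m - 2 ->
    p < n -> ~~ a p -> ~~ odd (below a p).
  move=> tr card_a lt_pn ap; apply: contra no_rb => odd_p.
  apply: (rainbow_of_selection (p := p.+1) tr lt_pn) => //.
    by rewrite belowS (negbTE ap) addn0.
  by rewrite card_a; lia.
have tr := @first_occ_transversal _ w n.
suff : n <= below (first_occ w) n + (below (first_occ w) n)./2.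
  by rewrite card_c; lia.
apply: unselected_le => p lt_pn ap; first exact: even_sel.
have [s le_sp [fs ws]] := first_occ_ex w p.
have lt_sp : s < p.
  by rewrite ltn_neqAle le_sp andbT; apply: contraNneq ap => <-.
split; first by lia.
apply: contraT => ap1.
have lt_sp1 : s < p.-1.
  have : s != p.-1 by apply: contraNneq ap1 => <-.
  by lia.
have lt_p1n : p.-1 < n by lia.
have tr' := exchange_transversal tr (ltn_trans lt_sp lt_pn) fs ws.
have card' q := below_exchange q fs ap.
have ap1' : ~~ exchange (first_occ w) s p p.-1.
  by rewrite /exchange (negbTE ap1) orbF; lia.
have card_exch : below (exchange (first_occ w) s p) n = 2 * m - 2.
  by have := card' n; rewrite card_c lt_pn (ltn_trans lt_sp lt_pn); lia.
(* Since [s < p.-1 < p], the exchange lowers the count below [p.-1] by exactly one, so the two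
   counts cannot both be even. *)
have := even_sel _ _ tr' card_exch lt_p1n ap1'.
have := even_sel _ _ tr card_c lt_p1n ap1.
by have := card' p.-1; lia.
Qed.

Lemma not_forces r (g h : nat -> nat) : 0 < r -> 0 < m ->
  (forall i, i < n -> g i < r) ->
  (forall k, k < r -> exists2 i, i < n & g i = k) ->
  (forall i, i < n -> h i < m.-1) ->
  (forall i j, i < j -> j < n -> h i = h j -> g i = g j \/ i.+1 = j) ->
  ~~ forces_rainbow P M r.
Proof.
case: r => // r _ m0 g_r g_onto h_m h_adj.
(* The larger endpoint of edge [i] is [i.+1], whence the predecessor. *)
pose c := [ffun e : {set P} => inord (g (\max_(x in e) (x : 'I_n.+1)).-1) : 'I_r.+1].
have cE i : i < n -> c (path_edge n i) = g i :> nat.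
  move=> lt_in; rewrite ffunE /path_edge big_setU1 /= ?big_set1.
    rewrite !inordK ?(maxn_idPr _) ?g_r //; lia.
  by rewrite inE -val_eqE /= !inordK; lia.
apply/forallPn; exists c; rewrite negb_imply; apply/andP; split.
  rewrite colors_usedE (_ : imset _ _ = setT) ?cardsT ?card_ord //.
  apply/setP => k; rewrite inE; apply/imsetP.
  have [i lt_in gi] := g_onto k (ltn_ord k).
  by exists (Ordinal lt_in) => //; apply: val_inj; rewrite /= cE.
apply/has_rainbowP => -[p [p_n p_inj p_sp]].
pose hp (i : 'I_m) : 'I_m.-1 := Ordinal (h_m _ (p_n i)).
(* Pigeonhole: [m] edges in [m.-1] classes. *)
have /injectivePn[i [j ne_ij]] : ~~ injectiveb hp.
  by apply: contraTN isT => /injectiveP/leq_card; rewrite !card_ord; lia.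
move=> /(congr1 val) /= eq_h.
have ne_g : g (p i) <> g (p j).
  move=> eq_g; case/eqP: ne_ij; apply: p_inj; apply: val_inj.
  by rewrite /= !cE.
case: (ltngtP (p i) (p j)) => [lt | lt | eq_p]; last by rewrite eq_p in ne_g.
  by have [] := h_adj _ _ lt (p_n j) eq_h; [exact: ne_g | exact: p_sp].
have [] := h_adj _ _ lt (p_n i) (esym eq_h); last exact: p_sp.
by move/esym; exact: ne_g.
Qed.

(** The positions from [r.-1] on share one colour and form class 0; the earlier ones have colours of
    their own and are paired backwards from there. *)
Lemma not_forces_few r : 0 < r -> r <= 2 * m - 3 -> 1 < m -> m <= uphalf n ->
  ~~ forces_rainbow P M r.
Proof.
move=> r0 r_m m1 m_n.
apply: (@not_forces _ (minn r.-1) (fun i => uphalf (r.-1 - i))) => //.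
- by lia.
- by move=> i; lia.
- by move=> k k_r; exists k; lia.
- by move=> i; lia.
- by move=> i j; lia.
Qed.

Lemma not_forces_short : 1 < m -> m <= uphalf n -> n <= 3 * m - 3 ->
  ~~ forces_rainbow P M (2 * m - 2).
Proof.
(* With [k] blocks of three followed by [m - 1 - k] blocks of two, the length is [n]. Block [j] has
   colours [2j] and [2j + 1], so halving a colour gives its block. *)
move=> m1 m_n n_m; pose k := n - (2 * m - 2).
pose g i := if i < 3 * k then 2 * (i %/ 3) + (i %% 3 == 1) else i - k.
apply: (@not_forces _ g (fun i => (g i)./2)); rewrite /g /k; first by lia.
- by lia.
- by move=> i; case: ifP; lia.
- move=> l l_m; case: (ltnP l (2 * k)) => l_k.
    by exists (3 * l./2 + odd l); rewrite /k in l_k *; [lia | case: ifP; lia].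
  by exists (l + k); rewrite /k in l_k *; [lia | case: ifP; lia].
- by move=> i; case: ifP; lia.
- by move=> i j; case: ifP; case: ifP; lia.
Qed.

End RainbowNumber.

Theorem theorem3p5 (n m : nat) (hn : 3 <= n) (hm2 : 2 <= m)
    (hm : m <= uphalf n) :
  rb (path_graph n) (matching_graph m) =
    if n <= 3 * m - 3 then 2 * m - 1 else 2 * m - 2.
Proof.
have few r r0 r_m := @not_forces_few n m r r0 r_m hm2 hm.
rewrite /rb; case: ex_minnP => r /andP[r0 forces_r] r_min.
(* Forcing is not assumed monotone in [r]: each smaller positive value is excluded by its own
   colouring. *)
have r_big : 2 * m - 2 <= r.
  by rewrite leqNgt; apply: contraL forces_r => lt_r; apply: few => //; lia.
apply/eqP; rewrite eqn_leq; case: ifP => n_m; apply/andP; split => //.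
- by apply: r_min; rewrite forces_odd ?andbT; lia.
- have ne : r != 2 * m - 2.
    by apply: contraTneq forces_r => ->; apply: not_forces_short.
  by lia.
- by apply: r_min; rewrite forces_even ?andbT //; lia.
Qed.
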